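(* Let $G$ be an Abelian group, $X$ a topological space with $|X|\geq 2$ (no separation axioms are assumed on $X$), and $f\colon G\to X$ a Korovin mapping. Let $G_f\subset X^G$ be the corresponding Korovin orbit, with the subspace topology inherited from the product space $X^G$. (1) If $X$ is not anti-discrete, then every countable subset of $G_f$ is closed and discrete in $G_f$. (2) If there exists a non-constant continuous real-valued function on $X$, then every countable subset of $G_f$ is $C^\ast$-embedded in $G_f$. (3) If there exists an unbounded continuous real-valued function on $X$, then every countable subset of $G_f$ is $C$-embedded in $G_f$.
   Context: Let $(G,+)$ be an Abelian group and $X$ a topological space with at least two elements. The group $G$ (carrying no topology) acts on the set $X^G$ of all maps $G\to X$ by $s\colon G\times X^G\to X^G$, $s(g,f)(h)=f(g+h)$ for $f\in X^G$, $g,h\in G$. An element $f\in X^G$ is called a Korovin mapping if for every $M\subset G$ with $|M|\leq\omega$ and every $h\in X^M$ there exists $g\in G$ such that $h=s(g,f)|_M$. For a Korovin mapping $f$, the Korovin orbit is the subspace $G_f=\{s(g,f): g\in G\}$ of $X^G$, where $X^G$ has the product topology. A space is anti-discrete if its only open sets are the empty set and the whole space. ''Countable'' means of cardinality at most $\omega$. A subset $Y$ of a space $Z$ is $C$-embedded (respectively $C^\ast$-embedded) in $Z$ if every continuous real-valued function (respectively every bounded continuous real-valued function) on $Y$ extends to a continuous real-valued function on $Z$. *)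

(* Defs.v *)
From HB Require Import structures.
From mathcomp Require Import all_boot all_order all_algebra.
From mathcomp Require Import all_classical all_reals.
From mathcomp Require Import topology normedtype.

Set Implicit Arguments.
Unset Strict Implicit.
Unset Printing Implicit Defensive.

Import Order.TTheory GRing.Theory Num.Theory.
Import numFieldNormedType.Exports.

Local Open Scope classical_set_scope.
Local Open Scope ring_scope.

(* Subsets [A] of a space are turned into spaces by the coercion [set_type],
   which carries the subspace (initial) topology; [sigL A f] is the restriction
   of [f] to [A], and [{ptws I -> X}] is [I -> X] with the product topology. *)

Definition anti_discrete (X : topologicalType) : Prop :=
  forall A : set X, open A -> A = set0 \/ A = setT.

(* The axiom of the library structure [discreteTopologicalType], as a
   predicate. *)
Definition discrete_space (X : topologicalType) : Prop :=
  @nbhs X X = principal_filter.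

Definition C_embedded (R : realType) (Z : topologicalType) (Y : set Z) : Prop :=
  forall g : Y -> R, continuous g ->
    exists2 h : Z -> R, continuous h & sigL Y h = g.

(* The extension is only required to be continuous, not bounded. *)
Definition Cstar_embedded (R : realType) (Z : topologicalType) (Y : set Z) :
    Prop :=
  forall g : Y -> R, continuous g -> bounded_fun g ->
    exists2 h : Z -> R, continuous h & sigL Y h = g.

Section Korovin.
Context (G : zmodType) (X : topologicalType).

Definition shift (g : G) (f : {ptws G -> X}) : {ptws G -> X} :=
  fun h => f (g + h).

Definition korovin_mapping (f : {ptws G -> X}) : Prop :=
  forall M : set G, countable M ->
    forall h : M -> X, exists g : G, h = sigL M (shift g f).

Definition korovin_orbit (f : {ptws G -> X}) : set {ptws G -> X} :=
  [set shift g f | g in [set: G]].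

End Korovin.

(* Main.v *)
Require Import Defs.
From HB Require Import structures.
From mathcomp Require Import all_boot all_order all_algebra.
From mathcomp Require Import all_classical all_reals.
From mathcomp Require Import topology normedtype.
From mathcomp Require Import ring lra.

Import Order.TTheory GRing.Theory Num.Theory.
Import numFieldNormedType.Exports.

Local Open Scope classical_set_scope.
Local Open Scope ring_scope.

(** The coordinates of the points of the orbit are continuous maps to [X], and
    the whole proof rests on [korovin_interpolation]: on a countable set [Y] of
    points of the orbit, a single coordinate [h] can be found at which the
    points of [Y] have any prescribed values in [X].

    If [X] has an open set other than the empty set and [X], the inverse images
    of this set under suitable coordinates separate each point from any
    countable set of other points, so countable sets are closed and discrete.

    If [phi] is a non-constant continuous function on [X], then for every subset
    of [Y] some coordinate followed by a normalised [phi] is a continuous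
    function with values in the unit interval that extends the indicator
    function of this subset. A bounded function on [Y] is, up to an affine
    change, a dyadic series of indicator functions; extending these term by
    term gives a uniformly convergent series on the orbit
    ([bounded_extension]). The image of [phi] may be disconnected, so
    [phi] alone need not take all the values of the function to be extended:
    this is why its values are split into binary digits.

    If [phi] is unbounded, a coordinate can be chosen along which the absolute
    value of [phi] exceeds that of a given function [g] on [Y]. Then [g] divided
    by a positive continuous function is bounded, and the bounded case
    applies. *)

(** * Extension of real functions from a subset of a space *)

Lemma uniformly_approximable_continuous (R : realType) (Z : topologicalType)
    (h : Z -> R) :
  (forall e : R, 0 < e ->
     exists2 s : Z -> R, continuous s & forall z, `|h z - s z| <= e) ->
  continuous h.
Proof.
move=> happrox z; apply/(@cvgrPdist_le R R^o) => e e0.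
have e3 : 0 < e / 3 by lra.
have [s s_cont hs] := happrox _ e3.
have /(@cvgrPdist_le R R^o)/(_ _ e3) := s_cont z.
apply: filterS => w /= szw.
move: (hs z) (hs w); move: szw; rewrite !ler_norml; lra.
Qed.

(** The hypotheses say that the intervals [[s n, s n + 2 ^- n]] are nested, so
    that the supremum of their left ends lies in all of them. The supremum thus
    serves as a limit that comes with an explicit rate. *)
Lemma dyadic_sup (R : realType) (s : nat -> R) :
  (forall n, s n <= s n.+1) ->
  (forall n, s n.+1 + 2^-1 ^+ n.+1 <= s n + 2^-1 ^+ n) ->
  forall n, s n <= sup (range s) <= s n + 2^-1 ^+ n.
Proof.
move=> s_incr u_decr n.
have s_homo : {homo s : i j / (i <= j)%N >-> i <= j}.
  by apply: homo_leq => // ? ? ?; exact: le_trans.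
have u_homo : {homo (fun n => s n + 2^-1 ^+ n) : i j / (i <= j)%N >-> j <= i}.
  apply: (@homo_leq _ _ (fun a b : R => b <= a)) => // ? ? ? ab bc.
  exact: le_trans bc ab.
have s_le_u i j : s i <= s j + 2^-1 ^+ j.
  apply: le_trans (s_homo _ _ (leq_maxl i j)) _.
  apply: le_trans (u_homo _ _ (leq_maxr i j)).
  by rewrite lerDl exprn_ge0// invr_ge0.
have ub j : ubound (range s) (s j + 2^-1 ^+ j) by move=> _ [i _ <-].
apply/andP; split.
  apply: ub_le_sup; [by exists (s 0%N + 2^-1 ^+ 0%N); exact: ub | by exists n].
by apply: ge_sup; [by exists (s 0%N); exists 0%N | exact: ub].
Qed.

Section Extension.
Context (R : realType) (Z : topologicalType) (Y : set Z).

(** A functional form of complete separation, in [Z], of every subset of [Y]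
    from its complement in [Y]; it holds exactly when [Y] is discrete and
    C*-embedded in [Z]. *)
Definition extends_indicators :=
  forall A : set Y, exists t : Z -> R, [/\ continuous t,
    forall z, 0 <= t z <= 1 & forall y : Y, t (set_val y) = (y \in A)%:R].

(** The binary expansion of [g] is computed uniformly over [Y]: the digits of
    order [n] form an indicator function on [Y], which extends to [Z]. Since
    the extensions keep values in [[0, 1]] on all of [Z], the dyadic series of
    the extended digits still converges uniformly there. *)
Lemma unit_extension :
  extends_indicators ->
  forall g : Y -> R, (forall y, 0 <= g y <= 1) ->
    exists2 h : Z -> R, continuous h & sigL Y h = g.
Proof.
move=> sep g g01.
pose half : R := 2^-1.
have half_gt0 n : 0 < half ^+ n by rewrite exprn_gt0// invr_gt0.
have halfS n : half ^+ n = 2 * half ^+ n.+1.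
  by rewrite exprS mulrA divff ?mul1r ?pnatr_eq0.
have /choice[t tP] : forall q : Y -> R, exists t : Z -> R, [/\ continuous t,
    forall z, 0 <= t z <= 1 & forall y : Y,
      t (set_val y) = (y \in [set y | 2^-1 <= q y])%:R].
  by move=> q; exact: sep.
(* [t q] extends the leading binary digit of [q]; [r n] is [g] with its first
   [n] digits shifted out, and [s n] the extended [n]-digit truncation. *)
pose r n := iter n (fun q y => 2 * q y - t q (set_val y)) g.
pose s n z := \sum_(k < n) half ^+ k.+1 * t (r k) z.
have r01 n y : 0 <= r n y <= 1.
  elim: n y => [//|n IHn] y /=.
  have [_ _ tr] := tP (r n).
  rewrite tr; move: (IHn y).
  case: (boolP (y \in _)); rewrite ?inE ?notin_setE /=; first by lra.
  by move=> /negP; rewrite -ltNge; lra.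
have sS n z : s n.+1 z = s n z + half ^+ n.+1 * t (r n) z.
  by rewrite /s big_ord_recr.
have rS n y : r n.+1 y = 2 * r n y - t (r n) (set_val y) by [].
have gE n y : g y = s n (set_val y) + half ^+ n * r n y.
  elim: n => [|n IHn]; first by rewrite /s big_ord0 expr0 add0r mul1r.
  by rewrite IHn sS (halfS n) rS; ring.
have s_cont n : continuous (s n).
  elim: n => [|n IHn].
    rewrite (_ : s 0%N = cst 0); first by move=> z; exact: cvg_cst.
    by apply/funext => z; rewrite /s big_ord0.
  rewrite (_ : s n.+1 = fun z => s n z + half ^+ n.+1 * t (r n) z); last first.
    by apply/funext => z; rewrite sS.
  move=> z; apply: (@cvgD R R^o); first exact: IHn.
  by apply: cvgM; [exact: cvg_cst|have [+ _ _] := tP (r n); exact].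
have t01 q z : 0 <= t q z <= 1 by have [_ + _] := tP q; exact.
pose h z := sup (range (s ^~ z)).
have h_approx n z : s n z <= h z <= s n z + half ^+ n.
  apply: (@dyadic_sup _ (s ^~ z)) => {}n.
    rewrite sS lerDl mulr_ge0 ?(ltW (half_gt0 _))//.
    by have /andP[] := t01 (r n) z.
  rewrite sS -/half [X in _ <= _ + X]halfS.
  by have := t01 (r n) z; have := half_gt0 n.+1; nra.
have small e : 0 < e -> exists n, half ^+ n <= e.
  move=> e0; exists (Num.bound e^-1).
  rewrite exprVn invf_ple ?posrE ?exprn_gt0//.
  by apply/ltW/upper_nthrootP.
exists h.
  apply: uniformly_approximable_continuous => e /small[n ne].
  exists (s n); first exact: s_cont.
  by move=> z; move: (h_approx n z); rewrite ler_norml; lra.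
apply/funext => y; rewrite /sigL /=.
apply/eqP; rewrite -subr_eq0 -normr_le0; apply/ler_addgt0Pl => e /small[n ne].
rewrite addr0 (le_trans _ ne)//.
move: (h_approx n (set_val y)) (r01 n y) (half_gt0 n).
by rewrite (gE n y) ler_norml; nra.
Qed.

Lemma bounded_extension :
  extends_indicators ->
  forall g : Y -> R, bounded_fun g ->
    exists2 h : Z -> R, continuous h & sigL Y h = g.
Proof.
move=> sep g /pinfty_ex_gt0[M M_gt0 gM0].
have gM y : `|g y| <= M by exact: gM0.
have [y|h h_cont hg] := unit_extension sep (fun y => (g y + M) / (2 * M)).
  have := gM y; rewrite ler_norml => /andP[gyl gyu].
  by rewrite ler_pdivlMr ?ler_pdivrMr ?mulr_gt0//; lra.
exists (fun z => 2 * M * h z - M).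
  move=> z; apply: (@cvgB R R^o); last exact: cvg_cst.
  by apply: cvgM; [exact: cvg_cst|exact: h_cont].
apply/funext => y; have := congr1 (fun u => u y) hg.
by rewrite /sigL /= => ->; field; rewrite gt_eqF.
Qed.

(** Dividing by [Phi] makes any function bounded by [Phi] on [Y] extendable, and
    multiplying the extension back by [Phi] keeps it continuous: this is how
    one passes from bounded to arbitrary functions. *)
Lemma dominated_extension :
  (forall g : Y -> R, bounded_fun g ->
     exists2 h : Z -> R, continuous h & sigL Y h = g) ->
  forall (g : Y -> R) (Phi : Z -> R), continuous Phi ->
    (forall z, 0 < Phi z) -> (forall y, `|g y| <= Phi (set_val y)) ->
  exists2 h : Z -> R, continuous h & sigL Y h = g.
Proof.
move=> ext g Phi Phi_cont Phi_gt0 gPhi.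
have [|h h_cont hg] := ext (fun y => g y / Phi (set_val y)).
  exists 1; split; [exact: num_real|move=> M M_gt1 y _ /=].
  rewrite (le_trans _ (ltW M_gt1))//.
  by rewrite normrM normfV (gtr0_norm (Phi_gt0 _)) ler_pdivrMr// mul1r.
exists (fun z => h z * Phi z).
  by move=> z; apply: cvgM; [exact: h_cont|exact: Phi_cont].
apply/funext => y; have := congr1 (fun u => u y) hg.
by rewrite /sigL /= => ->; rewrite divfK// gt_eqF.
Qed.

End Extension.

(** * Korovin orbits *)

Section KorovinOrbit.
Context (G : zmodType) (X : topologicalType) (f : {ptws G -> X}).

Definition orbit_eval (h : G) (z : korovin_orbit f) : X :=
  (set_val z : G -> X) h.

Lemma continuous_orbit_eval h : continuous (orbit_eval h).
Proof.
move=> z; apply: (@continuous_comp _ _ _ set_val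
  (fun u : {ptws G -> X} => u h)).
  exact: initial_continuous.
exact: (@proj_continuous G (fun=> X) h).
Qed.

(** On a countable set of points of the orbit, some coordinate takes any
    prescribed values. This exchanges the two roles of the group: the point
    [y = shift (a y) f] has coordinate [f (a y + h)] at [h], and by
    commutativity this is the value at [a y] of [shift h f], which the Korovin
    property prescribes on the countable set of all [a y]. *)
Lemma korovin_interpolation (hf : korovin_mapping f)
    (Y : set (korovin_orbit f)) :
  countable Y -> forall c : Y -> X,
  exists h : G, forall y : Y, orbit_eval h (set_val y) = c y.
Proof.
move=> Y_countable c.
have /choice[a aP] : forall z : korovin_orbit f, exists g : G,
    Defs.shift g f = set_val z.
  by move=> z; have [g _ gz] := set_valP z; exists g.
have /choice[p pP] : forall m : a @` Y, exists y : Y, a (set_val y) = set_val m.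
  move=> m; have [z Yz az] := set_valP m.
  by exists (exist _ z (mem_set Yz)).
have a_inj : injective a.
  by move=> z z' zz'; apply: val_inj; rewrite -[LHS]aP -[RHS]aP zz'.
have [h hP] := hf (a @` Y)
  (sub_countable (card_image_le _ _) Y_countable) (fun m => c (p m)).
exists h => y.
have aYy : a (set_val y) \in a @` Y.
  by apply/mem_set; exists (set_val y) => //; exact: set_valP.
(* Two points of [Y] never prescribe different values at the same group element,
   because [a] is injective. *)
pose m : a @` Y := exist (fun g => g \in a @` Y) _ aYy.
have := congr1 (fun u : a @` Y -> X => u m) hP; rewrite /sigL /=.
have -> : p m = y by apply: val_inj; apply: a_inj; rewrite pP.
by rewrite /orbit_eval -aP /Defs.shift addrC.
Qed.

(** A coordinate that lies in [U] at one point and outside [U] at countably many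
    others isolates this point from them by an open set. With the point outside
    [Y] this shows that [Y] is closed, with the point in [Y] that it is
    discrete. *)
Lemma countable_closed_discrete (hf : korovin_mapping f)
    (Y : set (korovin_orbit f)) :
  ~ anti_discrete X -> countable Y -> closed Y /\ discrete_space Y.
Proof.
move=> X_nad Y_countable.
have [U [U_open [p Up] [q Uq]]] :
    exists U : set X, [/\ open U, U !=set0 & (~` U) !=set0].
  apply: contrapT => noU; apply: X_nad => U U_open.
  have [->|U0] := eqVneq U set0; [by left|right].
  apply/seteqP; split=> // x _; apply: contrapT => Ux; apply: noU.
  by exists U; split=> //; [exact/set0P|exists x].
have separate (W : set (korovin_orbit f)) : countable W -> forall w, W w ->
    exists V : set (korovin_orbit f),
      [/\ open V, V w & forall w', W w' -> V w' -> w' = w].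
  move=> W_countable w Ww.
  have [h hP] := korovin_interpolation hf _ W_countable
    (fun w' => if set_val w' == w then p else q).
  have {}hP w' : W w' -> orbit_eval h w' = if w' == w then p else q.
    by move=> Ww'; exact: hP (exist (fun z => z \in W) w' (mem_set Ww')).
  exists (orbit_eval h @^-1` U); split.
  - apply: open_comp => // z _; exact: continuous_orbit_eval.
  - by rewrite /= hP// eqxx.
  - by move=> w' Ww' /=; rewrite hP//; case: eqP.
split.
  rewrite -openC openE => z nYz.
  have [||V [V_open Vz VY]] := separate (Y `|` [set z]) _ z.
  - rewrite -bigcup2E; apply: bigcup_countable; first exact: countableP.
    by case=> [|[|n]] _ //=; exact: countable1.
  - by right.
  rewrite /interior nbhsE; exists V => // w Vw Yw.
  by apply: nYz; rewrite -(VY w (or_introl Yw) Vw).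
apply/funext => y; apply/funext => A; apply/propext.
rewrite principal_filterP; split; first exact: nbhs_singleton.
move=> Ay.
have [V [V_open Vy VY]] := separate Y Y_countable (set_val y) (set_valP y).
exists (set_val @^-1` V); split=> //=; first by exists V.
by move=> y' Vy'; rewrite (_ : y' = y)//; apply/val_inj/VY => //;
  exact: set_valP.
Qed.

(** Interpolating two points of [X] that [phi] distinguishes turns each
    indicator function on [Y] into the composite of one coordinate with the
    absolute value of an affine normalisation of [phi], truncated at [1]. *)
Lemma orbit_bounded_extension (R : realType) (hf : korovin_mapping f)
    (phi : X -> R) (Y : set (korovin_orbit f)) :
  continuous phi -> (exists x y, phi x <> phi y) -> countable Y ->
  forall g : Y -> R, bounded_fun g ->
    exists2 h : korovin_orbit f -> R, continuous h & sigL Y h = g.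
Proof.
move=> phi_cont [p [q pq]] Y_countable; apply: bounded_extension => A.
pose rho x : R := (phi x - phi q) / (phi p - phi q).
pose psi x : R := Num.min `|rho x| 1.
have psi_cont : continuous psi.
  move=> x; apply: (@continuous_min R X (fun x => `|rho x|) (cst 1));
    last exact: cvg_cst.
  apply: (@cvg_norm R R^o); apply: cvgM; last exact: cvg_cst.
  by apply: (@cvgB R R^o); [exact: phi_cont|exact: cvg_cst].
have [h hP] := korovin_interpolation hf _ Y_countable
  (fun y => if y \in A then p else q).
exists (psi \o orbit_eval h); split.
- by move=> z; apply: continuous_comp;
    [exact: continuous_orbit_eval|exact: psi_cont].
- by move=> z; rewrite /= /psi le_min normr_ge0 ler01 ge_min lexx orbT.
- move=> y; rewrite /= hP /psi /rho; case: (y \in A).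
    by rewrite divff ?normr1 ?minxx// subr_eq0; exact/eqP.
  by rewrite subrr mul0r normr0; apply/min_idPl.
Qed.

(** As [phi] takes arbitrarily large absolute values, interpolation provides a
    coordinate along which it dominates the given function on [Y]. *)
Lemma orbit_extension (R : realType) (hf : korovin_mapping f)
    (phi : X -> R) (Y : set (korovin_orbit f)) :
  continuous phi -> ~ bounded_fun phi -> countable Y ->
  forall g : Y -> R,
    exists2 h : korovin_orbit f -> R, continuous h & sigL Y h = g.
Proof.
move=> phi_cont phi_unbd Y_countable g.
have phi_large M : exists x, M < `|phi x|.
  apply: contrapT => noM; apply: phi_unbd; exists M.
  split=> [|M' MM' x _ /=]; first exact: num_real.
  by rewrite (le_trans _ (ltW MM'))// leNgt; apply/negP => Mx; apply: noM;
    exists x.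
have phi_nonconst : exists x y, phi x <> phi y.
  have [x _] := phi_large 0; have [y xy] := phi_large `|phi x|.
  by exists x, y => eq_phi; move: xy; rewrite eq_phi ltxx.
have /choice[c cP] : forall y : Y, exists x, `|g y| < `|phi x|.
  by move=> y; exact: phi_large.
have [h hP] := korovin_interpolation hf _ Y_countable c.
(* Adding [1] makes the dominating function positive off [Y] as well. *)
pose psi x : R := `|phi x| + 1.
have psi_cont : continuous psi.
  move=> x; apply: (@cvgD R R^o); last exact: cvg_cst.
  by apply: (@cvg_norm R R^o); exact: phi_cont.
apply: (@dominated_extension _ _ _
  (orbit_bounded_extension _ hf _ _ phi_cont phi_nonconst Y_countable) _
  (psi \o orbit_eval h)).
- by move=> z; apply: continuous_comp;
    [exact: continuous_orbit_eval|exact: psi_cont].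
- by move=> z; rewrite /psi /= ltr_wpDl.
- by move=> y; rewrite /psi /= hP (le_trans (ltW (cP y)))// lerDl.
Qed.

End KorovinOrbit.

Theorem theorem2 (R : realType) (G : zmodType) (X : topologicalType)
    (hX : exists x y : X, x <> y)
    (f : {ptws G -> X}) (hf : korovin_mapping f) :
  (~ anti_discrete X ->
     forall Y : set (korovin_orbit f), countable Y ->
       closed Y /\ discrete_space Y) /\
  ((exists phi : X -> R, continuous phi /\ exists x y : X, phi x <> phi y) ->
     forall Y : set (korovin_orbit f), countable Y ->
       Cstar_embedded R Y) /\
  ((exists phi : X -> R, continuous phi /\ ~ bounded_fun phi) ->
     forall Y : set (korovin_orbit f), countable Y ->
       C_embedded R Y).
Proof.
split; last split.
- by move=> X_nad Y Y_countable; exact: countable_closed_discrete.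
- move=> [phi [phi_cont phi_nonconst]] Y Y_countable g _ g_bd.
  exact: orbit_bounded_extension phi_cont phi_nonconst Y_countable g g_bd.
- move=> [phi [phi_cont phi_unbd]] Y Y_countable g _.
  exact: orbit_extension phi_cont phi_unbd Y_countable g.
Qed.
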